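(* Let $\eta > 50$ be a constant (independent of $n$) and let $p = \frac{\eta \log n}{n-1}$. Consider the lazy simple random walk on a sequence $(G_t)_{t\in\mathbb{Z}}$ of independent Erdős–Rényi graphs on $[n]=\{1,\dots,n\}$ with edge probability $p$, with quenched mixing time $t_{\mathrm{mix}}(\varepsilon,0)$ (a random variable depending on the graph sequence). Then there exists a constant $c' = c'(\eta)$ such that for every $\varepsilon \in (0,1)$ $$\lim_{n \to \infty} \mathbf{P}\left(t_{\mathrm{mix}}(\varepsilon,0) \leq c' [\log n + \log(\varepsilon^{-1})]\right) = 1.$$
   Context: For each $n$ (large enough that $p\in(0,1)$), $(G_t)_{t\in\mathbb{Z}}$ are i.i.d. Erdős–Rényi random graphs on vertex set $[n]$, in which each pair of distinct vertices is joined by an edge independently with probability $p$. Write $\deg_t(x)$ for the degree of $x$ in $G_t$ and $x\sim_t y$ if $x,y$ are adjacent in $G_t$. The transition matrix $P_t$ is: $P_t(x,x)=1/2$ if $\deg_t(x)\ge 1$; $P_t(x,x)=1$ if $\deg_t(x)=0$; $P_t(x,y)=1/(2\deg_t(x))$ if $x\ne y$ and $x\sim_t y$; and $P_t(x,y)=0$ otherwise. $\mathbf{P}$ denotes the law of the random sequence $(P_s)_{s\in\mathbb{Z}}$ (for given $n$). For $s<t$ put $P^{s,t}=P_{s+1}\cdots P_t$ and let $P^{s,s}$ be the identity matrix. For $\mathbf{P}$-almost every sequence, for every $t\in\mathbb{Z}$ the limit $\pi_t(y)=\lim_{s\to-\infty}P^{s,t}(x,y)$ exists for all $x,y\in[n]$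 and does not depend on $x$; $\pi_t$ is a probability distribution on $[n]$. For such a sequence let $d(0,t)=\sup_{x\in[n]}\|P^{0,t}(x,\cdot)-\pi_t(\cdot)\|_{\mathrm{TV}}$, where $\|\mu-\nu\|_{\mathrm{TV}}=\frac12\sum_x|\mu(x)-\nu(x)|$, and $t_{\mathrm{mix}}(\varepsilon,0)=\inf\{t\ge 0: d(0,t)\le\varepsilon\}$ (over integers $t$). *)

(* Defs.v *)
From HB Require Import structures.
From mathcomp Require Import all_boot all_order all_algebra.
From mathcomp Require Import all_classical all_reals all_analysis.

Set Implicit Arguments.
Unset Strict Implicit.
Unset Printing Implicit Defensive.

Import Order.TTheory GRing.Theory Num.Theory.
Import numFieldNormedType.Exports.

Local Open Scope classical_set_scope.
Local Open Scope ring_scope.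

(* An edge is an unordered pair of distinct vertices, so every set of edges is
   a simple graph on 'I_n, and every simple graph arises exactly once. *)
Definition edge (n : nat) : finType := {e : {set 'I_n} | #|e| == 2%N}.

Definition sgraph (n : nat) : finType := {set edge n}.

Definition adj (n : nat) (g : sgraph n) (x y : 'I_n) : bool :=
  [exists e in (g : {set edge n}), val e == [set x; y]%SET].

Definition deg (n : nat) (g : sgraph n) (x : 'I_n) : nat :=
  #|[set y | adj g x y]%SET|.

Definition trans_mx (R : realType) (n : nat) (g : sgraph n) : 'M[R]_n :=
  \matrix_(x, y)
    if x == y then (if (0 < deg g x)%N then 2^-1 else 1)
    else if adj g x y then (2 * (deg g x)%:R)^-1 else 0.

Definition mutually_independent (d : measure_display) (T : measurableType d)
    (R : realType) (P : probability T R) (I : choiceType) (A : I -> set T) :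
    Prop :=
  forall s : seq I, uniq s ->
    P (\bigcap_(i in [set` s]) A i) = (\prod_(i <- s) P (A i))%E.

Definition erdos_renyi (d : measure_display) (T : measurableType d)
    (R : realType) (P : probability T R) (n : nat) (p : R)
    (G : T -> sgraph n) : Prop :=
  [/\ forall e : edge n, measurable [set w | e \in G w],
      forall e : edge n, P [set w | e \in G w] = p%:E
    & mutually_independent P (fun e : edge n => [set w | e \in G w])].

(* The graphs are identically distributed because they are all Erdos-Renyi
   with the same n and p. *)
Definition iid_erdos_renyi (d : measure_display) (T : measurableType d)
    (R : realType) (P : probability T R) (n : nat) (p : R)
    (G : int -> T -> sgraph n) : Prop :=
  (forall t : int, erdos_renyi P p (G t)) /\
  (forall A : int -> {set sgraph n},
     mutually_independent P (fun t : int => [set w | G t w \in A t])).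

(* P^{s,t} = P_{s+1} ... P_t; only meaningful for s <= t. *)
Definition prod_mx (R : realType) (n : nat) (Pm : int -> 'M[R]_n) (s t : int) :
    'M[R]_n :=
  \prod_(0 <= i < `|t - s|%N) Pm (s + 1 + i%:Z).

(* The limit s --> -oo over the integers is taken along s = t - k, k --> +oo. *)
Definition is_limit_law (R : realType) (n : nat) (Pm : int -> 'M[R]_n)
    (pi : int -> 'rV[R]_n) : Prop :=
  forall (t : int) (x y : 'I_n),
    (fun k : nat => prod_mx Pm (t - k%:Z) t x y) @ \oo --> pi t 0 y.

Definition tv_dist (R : realType) (n : nat) (mu nu : 'rV[R]_n) : R :=
  2^-1 * \sum_(x < n) `|mu 0 x - nu 0 x|.

(* The supremum over vertices is a finite maximum of nonnegative reals. *)
Definition mix_dist (R : realType) (n : nat) (Pm : int -> 'M[R]_n)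
    (pi : int -> 'rV[R]_n) (t : nat) : R :=
  \big[Num.max/0]_(x < n) tv_dist (row x (prod_mx Pm 0 t%:Z)) (pi t%:Z).

(* Extended-real valued: +oo when no time t qualifies. *)
Definition tmix (R : realType) (n : nat) (Pm : int -> 'M[R]_n)
    (pi : int -> 'rV[R]_n) (eps : R) : \bar R :=
  ereal_inf [set (t%:R)%:E | t in [set t : nat | mix_dist Pm pi t <= eps]].

Definition edge_prob (R : realType) (eta : R) (n : nat) : R :=
  eta * ln n%:R / (n%:R - 1).

(* Main.v *)
Require Import Defs.
From HB Require Import structures.
From mathcomp Require Import all_boot all_order all_algebra all_fingroup.
From mathcomp Require Import all_classical all_reals all_analysis.
From mathcomp Require Import ring lra zify.

(* The one-step transition matrix P of a fresh graph satisfies, by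
   exchangeability, E(P P^T) = a I + b J with b >= 0.  Hence a row vector mu of
   sum zero has E |mu P|^2 = a |mu|^2 in the Euclidean norm, and laziness gives
   a <= E(P P^T)_xx <= 1/2 + P(deg x = 0)/2 <= 1/2 + 1/(2(n-1)p) <= 3/4.
   Applied to differences of rows of P^{s,t}, the mean square distance between
   rows decays like (3/4)^(t-s).  By Markov's inequality the rows of P^{0,t}
   agree up to eps/n for t of order log n, with probability 1 - O(1/n); letting
   s tend to -oo, they almost surely coalesce, which produces pi_t. *)

Set Implicit Arguments.
Unset Strict Implicit.
Unset Printing Implicit Defensive.

Import Order.TTheory GRing.Theory Num.Theory.
Import numFieldNormedType.Exports.

Local Open Scope classical_set_scope.
Local Open Scope ring_scope.

(** * Relabelling vertices *)

(* Inclusion-exclusion: the probabilities [P(S \subset G)] determine the law of [G]. *)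
Lemma eq_from_upper_sums (V : zmodType) (E : finType) (f g : {set E} -> V) :
  (forall S : {set E}, \sum_(A : {set E} | S \subset A) f A
                       = \sum_(A : {set E} | S \subset A) g A) -> f =1 g.
Proof.
(* Induction on the size of the complement of [S]: every other superset of [S] has a smaller
   complement, so those terms agree and cancel. *)
move=> fg S; have [m] := ubnP #|~: S|; elim: m S => // m IHm S ltSm.
have := fg S; rewrite (bigD1 S) //= [in RHS](bigD1 S) //=.
under eq_bigr => A /andP[sSA neqAS].
  rewrite IHm; last first.
    apply: leq_trans (ltSm : _ <= m)%N; apply: proper_card.
    by rewrite properE !finset.setCS sSA; apply: contra neqAS => sAS; rewrite finset.eqEsubset sAS.
  over.
by move/addIr.
Qed.

Section Relabel.
Variable n : nat.
Implicit Types (s : {perm 'I_n}) (e : edge n) (g : sgraph n) (x y : 'I_n).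

Fact relabel_edge_subproof s e : #|[set s x | x in val e]%SET| == 2%N.
Proof. by rewrite card_imset ?(valP e) //; exact: perm_inj. Qed.

Definition relabel_edge s e : edge n := 
  exist (fun e : {set 'I_n} => #|e| == 2%N) _ (relabel_edge_subproof s e).

(** Pulling back along [s] makes adjacency of [x] and [y] the adjacency of [s x] and [s y] in [g],
    so no inverse permutation appears in the lemmas below. *)
Definition relabel s g : sgraph n := finset.preimset (relabel_edge s) (mem g).

Lemma relabel_edgeK s : cancel (relabel_edge s) (relabel_edge s^-1%g).
Proof.
move=> e; apply: val_inj => /=; rewrite -imset_comp -[RHS]imset_id.
by apply: eq_imset => x /=; rewrite permK.
Qed.

Lemma relabel_edgeVK s : cancel (relabel_edge s^-1%g) (relabel_edge s).
Proof. by move=> e; rewrite -{1}[s]invgK relabel_edgeK. Qed.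

Lemma relabelK s : cancel (relabel s) (relabel s^-1%g).
Proof. by move=> g; apply/setP => e; rewrite !inE relabel_edgeVK. Qed.

Lemma relabelVK s : cancel (relabel s^-1%g) (relabel s).
Proof. by move=> g; rewrite -{1}[s]invgK relabelK. Qed.

Lemma adj_relabel s g x y : adj (relabel s g) x y = adj g (s x) (s y).
Proof.
apply/existsP/existsP => [[e /andP[]]|[e /andP[eg /eqP exy]]].
  rewrite inE => eg /eqP exy; exists (relabel_edge s e); rewrite eg /= exy.
  by rewrite imsetU1 imset_set1.
exists (relabel_edge s^-1%g e); rewrite inE relabel_edgeVK eg /= exy.
by rewrite imsetU1 imset_set1 !permK.
Qed.

Lemma deg_relabel s g x : deg (relabel s g) x = deg g (s x).
Proof.
rewrite /deg -(card_imset _ (@perm_inj _ s)); apply: eq_card => y.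
rewrite inE; apply/imsetP/idP => [[z]|gxy].
  by rewrite inE adj_relabel => gxz ->.
by exists (s^-1%g y); rewrite ?permKV // inE adj_relabel permKV.
Qed.

Lemma trans_mx_relabel (R : realType) s g x y :
  trans_mx R (relabel s g) x y = trans_mx R g (s x) (s y).
Proof. by rewrite !mxE deg_relabel adj_relabel (inj_eq perm_inj). Qed.

End Relabel.

(** * Rows of the one-step transition matrix *)

Section TransMx.
Variables (R : realType) (n : nat).
Implicit Types (g : sgraph n) (x y : 'I_n).

Lemma adj_irrefl g x : adj g x x = false.
Proof.
apply/negbTE/existsP => -[e /andP[_ /eqP ex]].
by have := valP e; rewrite ex finset.setUid cards1.
Qed.

Lemma trans_mx_ge0 g x y : 0 <= trans_mx R g x y.
Proof. by rewrite mxE; repeat case: ifP => _ //; rewrite ?invr_ge0 // mulr_ge0. Qed.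

Lemma trans_mx_sum g x : \sum_y trans_mx R g x y = 1.
Proof.
rewrite (bigD1 x) //= mxE eqxx.
rewrite (eq_bigr (fun y => if adj g x y then (2 * (deg g x)%:R)^-1 else 0)); last first.
  by move=> y /negbTE neyx; rewrite mxE eq_sym neyx.
rewrite -big_mkcondr /= (eq_bigl (mem [set y | adj g x y]%SET)); last first.
  by move=> y; rewrite !inE; case: (eqVneq y x) => [->|] //=; rewrite adj_irrefl.
rewrite sumr_const -/(deg g x) -[_ *+ deg g x]mulr_natr.
case: ltnP => [d0|]; last by rewrite leqn0 => /eqP ->; rewrite mulr0 addr0.
have : (deg g x)%:R != 0 :> R by rewrite pnatr_eq0 -lt0n.
by move: ((deg g x)%:R : R) => z z0; field.
Qed.

(** A probability vector has square sum at most its largest entry. That entry is 1/2 when [x] has a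
    neighbour, by laziness, and 1 when [x] is isolated. *)
Lemma trans_mx_sqr_sum g x :
  \sum_y trans_mx R g x y ^+ 2 <= 2^-1 + 2^-1 * (deg g x == 0)%:R.
Proof.
suff le_max y : trans_mx R g x y <= 2^-1 + 2^-1 * (deg g x == 0)%:R.
  apply: (@le_trans _ _ (\sum_y trans_mx R g x y * (2^-1 + 2^-1 * (deg g x == 0)%:R))).
    apply: ler_sum => y _; rewrite expr2 ler_wpM2l //; exact: trans_mx_ge0.
  by rewrite -mulr_suml trans_mx_sum mul1r.
rewrite mxE lt0n; have [->|d0] := eqVneq (deg g x) 0%N; rewrite /= ?mulr1 ?mulr0 ?addr0.
  (* At degree zero the branch for neighbours takes the default value [0^-1 = 0]. *)
  by rewrite invr0; do 2?case: ifP => _; lra.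
case: ifP => _ //; case: ifP => _; last lra.
rewrite lef_pV2 ?posrE ?mulr_gt0 ?ltr0n ?lt0n //.
by rewrite ler_peMr // ler1n lt0n.
Qed.

End TransMx.

(** * The law of one Erdos-Renyi graph *)

Lemma adj_edge (n : nat) (g : sgraph n) (x y : 'I_n) (e : edge n) :
  val e = [set x; y]%SET -> adj g x y = (e \in (g : {set edge n})).
Proof.
move=> exy; apply/existsP/idP => [[e' /andP[e'g /eqP e'xy]]|eg].
  by rewrite (_ : e = e') //; apply: val_inj; rewrite exy e'xy.
by exists e; rewrite eg exy /=.
Qed.

Lemma edge_of (n : nat) (x y : 'I_n) : x != y -> {e : edge n | val e = [set x; y]%SET}.
Proof.
move=> xy; have cxy : #|[set x; y]%SET| == 2%N by rewrite cards2 xy.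
by exists (exist (fun e : {set 'I_n} => #|e| == 2%N) _ cxy).
Qed.

Section ErdosRenyiLaw.
Variables (R : realType) (n : nat) (p : R) (q : sgraph n -> R).
Hypothesis p_gt0 : 0 < p.
Hypothesis n_gt1 : (1 < n)%N.
Hypothesis q_ge0 : forall g, 0 <= q g.
Hypothesis q_upper : forall S : {set edge n},
  \sum_(g : {set edge n} | S \subset g) q g = p ^+ #|S|.

Lemma law_sum1 : \sum_g q g = 1.
Proof.
by rewrite -(expr0 p) -(cards0 (edge n)) -q_upper; apply: eq_bigl => g; rewrite finset.sub0set.
Qed.

(** Exchangeability: relabelling carries [S] to an edge set of the same size, and the upper sums
    depend on that size alone. *)
Lemma law_relabel s g : q (relabel s g) = q g.
Proof.
move: g; apply: eq_from_upper_sums => S; rewrite q_upper.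
rewrite (reindex_inj (can_inj (relabelK s^-1%g))) /=.
have inj_s := can_inj (relabel_edgeK s^-1%g).
rewrite -(card_imset (mem S) inj_s) -q_upper; apply: eq_big => g.
  by rewrite sub_imset_pre.
by rewrite relabelVK.
Qed.

Lemma law_adj x y : x != y -> \sum_g q g * (adj g x y)%:R = p.
Proof.
move=> /edge_of[e exy]; rewrite -[RHS]expr1 -(cards1 e) -q_upper [RHS]big_mkcond /=.
apply: eq_bigr => g _; rewrite (adj_edge _ exy) finset.sub1set.
by case: ifP => _; rewrite ?mulr1 ?mulr0.
Qed.

Lemma law_adj2 x y z : x != y -> x != z -> y != z ->
  \sum_g q g * ((adj g x y)%:R * (adj g x z)%:R) = p ^+ 2.
Proof.
move=> xy xz yz; have [e exy] := edge_of xy; have [f fxz] := edge_of xz.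
have ef : e != f.
  apply: contraNneq yz => ef; have : y \in [set x; z]%SET.
    by rewrite -fxz -ef exy !inE eqxx orbT.
  by rewrite !inE eq_sym (negbTE xy).
rewrite (_ : 2%N = #|[set e; f]%SET|); last by rewrite cards2 ef.
rewrite -q_upper [RHS]big_mkcond /=; apply: eq_bigr => g _.
rewrite (adj_edge _ exy) (adj_edge _ fxz) finset.subUset !finset.sub1set.
by do 2!case: (_ \in g); rewrite ?mulr1 ?mulr0.
Qed.

Lemma deg_sum (g : sgraph n) (x : 'I_n) : (deg g x)%:R = \sum_(y | y != x) (adj g x y)%:R :> R.
Proof.
rewrite /deg -sum1_card natr_sum big_mkcond [RHS]big_mkcond /=; apply: eq_bigr => y _.
by rewrite inE; case: eqVneq => [->|_] /=; rewrite ?adj_irrefl; case: (adj g x y).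
Qed.

Lemma card_neq (x : 'I_n) : #|[pred y | y != x]| = n.-1.
Proof. by rewrite cardC1 card_ord. Qed.

(* Chebyshev: [1_{deg = 0} <= (1 - deg / m)^2] with [m] the mean degree. *)
Lemma law_isolated x : \sum_g q g * (deg g x == 0)%:R <= (n.-1%:R * p)^-1.
Proof.
set m := n.-1%:R * p; have n1_gt0 : 0 < n.-1%:R :> R by rewrite ltr0n; lia.
have m_gt0 : 0 < m by rewrite mulr_gt0.
have first : \sum_g q g * (deg g x)%:R = m.
  under eq_bigr do rewrite deg_sum mulr_sumr.
  rewrite exchange_big /= (eq_bigr (fun=> p)) => [|y yx].
    by rewrite sumr_const card_neq /m mulr_natl.
  by rewrite law_adj // eq_sym.
have second : \sum_g q g * (deg g x)%:R ^+ 2 <= m + m ^+ 2.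
  have -> : \sum_g q g * (deg g x)%:R ^+ 2 = \sum_(y | y != x) \sum_(z | z != x)
      \sum_g q g * ((adj g x y)%:R * (adj g x z)%:R).
    under eq_bigr do rewrite deg_sum expr2 big_distrlr /= mulr_sumr.
    rewrite exchange_big /=; apply: eq_bigr => y _.
    under eq_bigr do rewrite mulr_sumr.
    by rewrite exchange_big.
  (* The pair [z = y] contributes [p]. Keeping [z = y] in the sum of [p ^+ 2] as well only enlarges
     the bound and gives [m + m ^+ 2] after counting. *)
  apply: (@le_trans _ _ (\sum_(y | y != x) (p + \sum_(z | z != x) p ^+ 2))).
    apply: ler_sum => y yx; rewrite (bigD1 y) //= lerD //.
      rewrite le_eqVlt; apply/orP; left; apply/eqP.
      rewrite -[RHS](@law_adj x y) 1?eq_sym //; apply: eq_bigr => g _.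
      by case: (adj g x y); rewrite ?mulr1 ?mulr0.
    rewrite [leRHS](bigD1 y) //= -[leLHS]add0r lerD ?sqr_ge0 //.
    apply: ler_sum => z /andP[zx zy]; rewrite law_adj2 // eq_sym //.
  rewrite sumr_const card_neq sumr_const card_neq -[_ *+ _]mulr_natr.
  by rewrite -[p ^+ 2 *+ _]mulr_natr /m le_eqVlt; apply/orP; left; apply/eqP; ring.
have cheb g : q g * (deg g x == 0)%:R <=
    q g - 2 / m * (q g * (deg g x)%:R) + (m ^+ 2)^-1 * (q g * (deg g x)%:R ^+ 2).
  rewrite [leRHS](_ : _ = q g * (1 - (deg g x)%:R / m) ^+ 2); last first.
    by field; rewrite gt_eqF.
  apply: ler_wpM2l => //; case: eqP => [->|_]; last exact: sqr_ge0.
  by rewrite mul0r subr0 expr1n.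
apply: le_trans; first by apply: ler_sum => g _; exact: cheb.
rewrite big_split sumrB /= -!mulr_sumr law_sum1 first.
(* Inserting the two moments gives [1 - 2 + m^-1 + 1 = m^-1]. *)
apply: (@le_trans _ _ (1 - 2 / m * m + (m ^+ 2)^-1 * (m + m ^+ 2))).
  by rewrite lerD2l ler_wpM2l // invr_ge0 sqr_ge0.
by rewrite le_eqVlt; apply/orP; left; apply/eqP; field; rewrite gt_eqF.
Qed.

(** The entries of E(P P^T): the probability that walkers from [x] and [y], moving independently on
    the same random graph, meet after one step. *)
Definition gram (x y : 'I_n) : R :=
  \sum_g q g * \sum_z trans_mx R g x z * trans_mx R g y z.

Lemma gram_sym x y : gram x y = gram y x.
Proof. by apply: eq_bigr => g _; congr *%R; apply: eq_bigr => z _; rewrite mulrC. Qed.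

Lemma gram_ge0 x y : 0 <= gram x y.
Proof.
apply: sumr_ge0 => g _; apply: mulr_ge0 => //; apply: sumr_ge0 => z _.
by rewrite mulr_ge0 ?trans_mx_ge0.
Qed.

Lemma gram_perm (s : {perm 'I_n}) x y : gram (s x) (s y) = gram x y.
Proof.
rewrite /gram (reindex_inj (can_inj (relabelK s^-1%g))) /=.
apply: eq_bigr => g _; rewrite law_relabel; congr *%R.
rewrite (reindex_inj (@perm_inj _ s)) /=; apply: eq_bigr => z _.
by rewrite !trans_mx_relabel !permK.
Qed.

(** The transposition of [x] and [u] fixes [y]. *)
Lemma gram_move x y u : x != y -> u != y -> gram x y = gram u y.
Proof.
by move=> xy uy; rewrite -(gram_perm (tperm x u)) tpermL tpermD.
Qed.

(** The indices are moved one at a time. When [u = y] the first move would land on the diagonal;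
    symmetry then reduces the claim to a single move. *)
Lemma gram_offdiag x y u v : x != y -> u != v -> gram x y = gram u v.
Proof.
move=> xy uv; have [uy|uy] := eqVneq u y.
  rewrite uy in uv *.
  by rewrite [RHS]gram_sym; apply: gram_move; rewrite // eq_sym.
by rewrite (gram_move xy uy) gram_sym [RHS]gram_sym; apply: gram_move; rewrite eq_sym.
Qed.

Lemma gram_diag x : gram x x <= 2^-1 + 2^-1 * (n.-1%:R * p)^-1.
Proof.
apply: (@le_trans _ _ (\sum_g q g * (2^-1 + 2^-1 * (deg g x == 0)%:R))).
  apply: ler_sum => g _; apply: ler_wpM2l => //; exact: trans_mx_sqr_sum.
under eq_bigr do rewrite mulrDr mulrCA.
rewrite big_split /= -mulr_suml law_sum1 mul1r -mulr_sumr lerD2l ler_wpM2l ?law_isolated //.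
Qed.

(** The left side is the quadratic form of [gram] at [mu]. The constant off-diagonal part
    contributes [b] times the square of the sum of [mu], which is 0; what remains is diagonal, with
    weights [gram x x - b] at most [gram x x]. *)
Lemma trans_mx_contract (mu : 'rV[R]_n) : \sum_x mu 0 x = 0 ->
  \sum_g q g * \sum_y (mu *m trans_mx R g) 0 y ^+ 2 <=
  (2^-1 + 2^-1 * (n.-1%:R * p)^-1) * \sum_x mu 0 x ^+ 2.
Proof.
move=> mu0.
(* The common off-diagonal value, read off at the vertices 0 and 1. *)
pose b := gram (Ordinal (ltnW n_gt1)) (Ordinal n_gt1).
have gramE x y : gram x y = b + (x == y)%:R * (gram x x - b).
  have [<-|xy] := eqVneq x y; first by rewrite mul1r addrC subrK.
  by rewrite mul0r addr0; apply: gram_offdiag.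
have -> : \sum_g q g * \sum_y (mu *m trans_mx R g) 0 y ^+ 2 =
    \sum_x \sum_y mu 0 x * mu 0 y * gram x y.
  rewrite /gram; under [RHS]eq_bigr do under eq_bigr do rewrite mulr_sumr.
  under [RHS]eq_bigr do rewrite exchange_big /=.
  rewrite [RHS]exchange_big /=; apply: eq_bigr => g _.
  have -> : \sum_y (mu *m trans_mx R g) 0 y ^+ 2 =
    \sum_z \sum_x \sum_y mu 0 x * mu 0 y * (trans_mx R g x z * trans_mx R g y z).
    apply: eq_bigr => z _; rewrite !mxE expr2 big_distrlr /=.
    by apply: eq_bigr => x _; apply: eq_bigr => y _; ring.
  rewrite exchange_big mulr_sumr /=; apply: eq_bigr => x _.
  rewrite exchange_big mulr_sumr /=; apply: eq_bigr => y _.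
  by rewrite -mulr_sumr mulrCA.
have -> : \sum_x \sum_y mu 0 x * mu 0 y * gram x y =
    \sum_x mu 0 x ^+ 2 * (gram x x - b).
  transitivity (\sum_x (mu 0 x * b * \sum_y mu 0 y + mu 0 x ^+ 2 * (gram x x - b))).
    apply: eq_bigr => x _; under eq_bigr do rewrite gramE mulrDr.
    rewrite big_split /=; congr +%R.
      by rewrite mulr_sumr; apply: eq_bigr => y _; ring.
    rewrite (bigD1 x) //= eqxx big1 ?addr0 ?mul1r ?expr2 // => y yx.
    by rewrite eq_sym (negbTE yx) mul0r mulr0.
  by apply: eq_bigr => x _; rewrite mu0 mulr0 add0r.
rewrite mulr_sumr; apply: ler_sum => x _; rewrite mulrC ler_wpM2r ?sqr_ge0 //.
by rewrite lerBlDr (le_trans (gram_diag x)) // lerDl gram_ge0.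
Qed.

End ErdosRenyiLaw.

(** * Products of transition matrices and their energy *)

Section Stochastic.
Variables (R : realType) (n : nat).
Implicit Types A B Q : 'M[R]_n.

Definition stochastic A := (forall x y, 0 <= A x y) /\ (forall x, \sum_y A x y = 1).

Lemma stochastic1 : stochastic 1%:M.
Proof.
split=> [x y|x]; first by rewrite mxE ler0n.
by rewrite (bigD1 x) //= mxE eqxx big1 ?addr0 // => y /negbTE yx; rewrite mxE eq_sym yx.
Qed.

Lemma stochasticM A B : stochastic A -> stochastic B -> stochastic (A *m B).
Proof.
move=> [A0 A1] [B0 B1]; split=> [x y|x].
  by rewrite mxE sumr_ge0 // => z _; rewrite mulr_ge0.
under eq_bigr do rewrite mxE.
rewrite exchange_big /= -[RHS](A1 x); apply: eq_bigr => z _.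
by rewrite -mulr_sumr B1 mulr1.
Qed.

Lemma stochastic_trans g : stochastic (trans_mx R g).
Proof. by split=> *; [exact: trans_mx_ge0 | exact: trans_mx_sum]. Qed.

(* Lists of graphs are kept in reverse chronological order. *)
Definition walk_mx (l : seq (sgraph n)) : 'M[R]_n :=
  foldr (fun g Q => Q *m trans_mx R g) 1%:M l.

Lemma walk_mx_cat l1 l2 : walk_mx (l1 ++ l2) = walk_mx l2 *m walk_mx l1.
Proof. by elim: l1 => [|g l1 IH] /=; rewrite ?mulmx1 // IH mulmxA. Qed.

Lemma stochastic_walk l : stochastic (walk_mx l).
Proof.
elim: l => [|g l IH] /=; first exact: stochastic1.
by apply: stochasticM => //; exact: stochastic_trans.
Qed.

(** Boolean, so that it can filter finite sums over tuples of graphs. *)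
Definition osc_le (dlt : R) Q : bool :=
  [forall x, forall x', forall y, `|Q x y - Q x' y| <= dlt].

Lemma osc_leP dlt Q :
  reflect (forall x x' y, `|Q x y - Q x' y| <= dlt) (osc_le dlt Q).
Proof.
apply: (iffP forallP) => [h x x' y|h x].
  by have /forallP/(_ x')/forallP/(_ y) := h x.
by apply/forallP => x'; apply/forallP => y.
Qed.

Lemma average_dist dlt A Q c x y : stochastic A ->
  (forall z, `|Q z y - c| <= dlt) -> `|(A *m Q) x y - c| <= dlt.
Proof.
move=> [A0 A1] Qc; rewrite mxE.
have -> : \sum_z A x z * Q z y - c = \sum_z A x z * (Q z y - c).
  under [RHS]eq_bigr do rewrite mulrBr.
  by rewrite sumrB -mulr_suml A1 mul1r.
apply: le_trans (ler_norm_sum _ _ _) _.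
rewrite -[dlt]mul1r -(A1 x) mulr_suml; apply: ler_sum => z _.
by rewrite normrM ger0_norm // ler_wpM2l.
Qed.

Lemma osc_le_average dlt A Q x x' y : stochastic A -> osc_le dlt Q ->
  `|(A *m Q) x y - Q x' y| <= dlt.
Proof. by move=> stA /osc_leP osc; apply: average_dist. Qed.

(** Rows of [A *m Q] are averages of rows of [Q]. Hence starting the walk earlier, which multiplies
    on the left, never spreads the rows apart. *)
Lemma osc_leM dlt A Q : stochastic A -> osc_le dlt Q -> osc_le dlt (A *m Q).
Proof.
move=> stA osc; apply/osc_leP => x x' y; apply: average_dist => // z.
by rewrite distrC; apply: osc_le_average.
Qed.

(** A quadratic substitute for the oscillation: its mean over a fresh graph can be bounded
    separately for each pair of rows. *)
Definition energy Q : R := \sum_x \sum_x' \sum_y (Q x y - Q x' y) ^+ 2.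

Lemma energy_ge0 Q : 0 <= energy Q.
Proof. by do 3!(apply: sumr_ge0 => ? _); exact: sqr_ge0. Qed.

Lemma energy_osc dlt Q : 0 <= dlt -> ~~ osc_le dlt Q -> dlt ^+ 2 <= energy Q.
Proof.
move=> dlt0; rewrite negb_forall => /existsP[x]; rewrite negb_forall => /existsP[x'].
rewrite negb_forall => /existsP[y]; rewrite -ltNge => /ltW lt.
rewrite /energy (bigD1 x) //= (bigD1 x') //= (bigD1 y) //= -!addrA.
apply: (@le_trans _ _ ((Q x y - Q x' y) ^+ 2)).
  by rewrite -[leRHS]real_normK ?num_real // lerXn2r // nnegrE.
by rewrite lerDl !addr_ge0 //; do ?(apply: sumr_ge0 => ? _); exact: sqr_ge0.
Qed.

(** There are [n ^ 3] terms, each at most 1. This bounds the energy of the empty walk, where the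
    decay starts. *)
Lemma energy_le Q : stochastic Q -> energy Q <= n%:R ^+ 3.
Proof.
move=> [Q0 Q1].
have Qle1 x y : Q x y <= 1 by rewrite -(Q1 x) (bigD1 y) //= lerDl sumr_ge0.
apply: (@le_trans _ _ (\sum_(x < n) \sum_(x' < n) \sum_(y < n) 1)); last first.
  by rewrite !sumr_const !card_ord -!mulrnA -natrX !expnS expn0 muln1 mulnA.
apply: ler_sum => x _; apply: ler_sum => x' _; apply: ler_sum => y _.
have := (Q0 x y, Q0 x' y, Qle1 x y, Qle1 x' y); case=> [[[]]] ? ? ? ?.
by nra.
Qed.

End Stochastic.

(** Splits off the head of the tuple, which is the newest graph, so that it can be averaged with the
    earlier ones held fixed. *)
Lemma big_tuple_cons (V : nmodType) (S : finType) (k : nat) (D : pred (seq S)) (F : seq S -> V) :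
  \sum_(l : k.+1.-tuple S | D l) F l =
  \sum_(l : k.-tuple S) \sum_(g | D (g :: l)) F (g :: l).
Proof.
pose h (u : k.-tuple S * S) : k.+1.-tuple S := [tuple of u.2 :: u.1].
pose h' (l : k.+1.-tuple S) := (behead_tuple l, thead l).
have hK : cancel h h'.
  by case=> l g; rewrite /h /h'; congr pair; apply: val_inj.
have h'K : cancel h' h by move=> l; rewrite /h /= -tuple_eta.
rewrite (reindex h) /=; last by exists h' => u _; [exact: hK | exact: h'K].
by rewrite pair_big_dep.
Qed.

(** * Geometric decay of the mean energy *)

Section EnergyDecay.
Variables (R : realType) (n : nat) (p : R) (q : sgraph n -> R).
Hypothesis p_gt0 : 0 < p.
Hypothesis n_gt1 : (1 < n)%N.
Hypothesis q_ge0 : forall g, 0 <= q g.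
Hypothesis q_upper : forall S : {set edge n},
  \sum_(g : {set edge n} | S \subset g) q g = p ^+ #|S|.

Let r : R := 2^-1 + 2^-1 * (n.-1%:R * p)^-1.

(** Two rows of a stochastic matrix differ by a vector of sum zero, to which [trans_mx_contract]
    applies. *)
Lemma energy_contract Q : stochastic Q ->
  \sum_g q g * energy (Q *m trans_mx R g) <= r * energy Q.
Proof.
move=> [_ Q1]; rewrite /energy mulr_sumr.
under eq_bigr do rewrite mulr_sumr.
rewrite exchange_big /=; apply: ler_sum => x _.
under eq_bigr do rewrite mulr_sumr.
rewrite exchange_big /= mulr_sumr; apply: ler_sum => x' _.
have mu0 : \sum_y (row x Q - row x' Q) 0 y = 0.
  by under eq_bigr do rewrite !mxE; rewrite sumrB !Q1 subrr.
have := trans_mx_contract p_gt0 n_gt1 q_ge0 q_upper mu0.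
congr (_ <= _); last by congr *%R; apply: eq_bigr => y _; rewrite !mxE.
apply: eq_bigr => g _; congr *%R; apply: eq_bigr => y _.
by rewrite mulmxBl -!row_mul !mxE.
Qed.

Lemma energy_mean k :
  \sum_(l : k.-tuple (sgraph n)) (\prod_(g <- l) q g) * energy (walk_mx R l)
  <= r ^+ k * n%:R ^+ 3.
Proof.
have r_ge0 : 0 <= r by rewrite addr_ge0 ?mulr_ge0 ?invr_ge0 ?mulr_ge0 // ltW.
elim: k => [|k IH].
  rewrite (big_pred1 [tuple]) => [|l]; last by apply/esym/eqP; exact: tuple0.
  by rewrite /= big_nil expr0 !mul1r; exact/energy_le/stochastic1.
rewrite (@big_tuple_cons _ _ _ xpredT (fun l => (\prod_(g <- l) q g) * energy (walk_mx R l))) /=.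
rewrite exprS -mulrA; apply: le_trans (ler_wpM2l r_ge0 IH).
rewrite mulr_sumr; apply: ler_sum => l _.
under eq_bigr do rewrite big_cons mulrAC mulrC.
rewrite -mulr_sumr mulrCA ler_wpM2l ?prodr_ge0 //.
exact/energy_contract/stochastic_walk.
Qed.

(** Markov's inequality for the energy, which is at least [dlt ^+ 2] as soon as one entry difference
    exceeds [dlt]. *)
Lemma osc_markov k (dlt : R) : 0 < dlt ->
  \sum_(l : k.-tuple (sgraph n) | ~~ osc_le dlt (walk_mx R l)) \prod_(g <- l) q g
  <= r ^+ k * n%:R ^+ 3 / dlt ^+ 2.
Proof.
move=> dlt0; have dlt2 : 0 < dlt ^+ 2 by rewrite exprn_gt0.
rewrite ler_pdivlMr // mulr_suml; apply: le_trans (energy_mean k).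
rewrite big_mkcond /=; apply: ler_sum => l _; case: ifPn => [osc|_].
  by rewrite ler_wpM2l ?prodr_ge0 // energy_osc // ltW.
by rewrite mulr_ge0 ?energy_ge0 ?prodr_ge0.
Qed.

End EnergyDecay.

(** * Limit laws and mixing of a fixed sequence *)

Section Past.
Variables (R : realType) (n : nat) (G : int -> sgraph n).
Local Notation Pm := (fun t : int => trans_mx R (G t)).

(** Runs from [G t] back to [G (t - k + 1)]: the factors of P^{t-k,t}, newest first as [walk_mx]
    expects. *)
Definition past (t : int) (k : nat) : k.-tuple (sgraph n) :=
  map_tuple (fun i : nat => G (t - i%:Z)) (iota_tuple k 0).

Local Notation W t k := (walk_mx R (past t k)).

Lemma past_cat t k m :
  past t (k + m) = past t k ++ past (t - k%:Z) m :> seq (sgraph n).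
Proof.
rewrite /= iotaD map_cat; congr cat; rewrite add0n -[k in iota k]addn0 iotaDl -map_comp.
by apply: eq_map => i /=; rewrite PoszD opprD addrA.
Qed.

Lemma prod_mx_past t k : prod_mx Pm (t - k%:Z) t = W t k.
Proof.
rewrite /prod_mx opprB addrC subrK absz_nat.
elim: k t => [|k IH] t; first by rewrite big_nil.
rewrite -[past t k.+1 : seq _]/(tval (past t k.+1)) -addn1 addnC past_cat walk_mx_cat.
rewrite add1n big_nat_recr //= -IH.
rewrite mul1mx subr0; congr (_ *m trans_mx R (G _)).
  by apply: eq_bigr => i _; congr (trans_mx R (G _)); rewrite -natz; lia.
lia.
Qed.

Lemma walk_past_split t k m : (k <= m)%N -> exists2 A, stochastic A & W t m = A *m W t k.
Proof.
move=> km; rewrite -(subnKC km) past_cat walk_mx_cat; eexists; last by [].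
exact: stochastic_walk.
Qed.

(** Coalescence of the rows in the remote past, phrased with countable quantifiers so that it
    defines a measurable event. One [k] per tolerance is enough, since by [osc_leM] closeness
    persists for every longer past. *)
Definition settles := forall (t : int) (j : nat), exists k : nat, osc_le j.+1%:R^-1 (W t k).

Lemma settles_osc t (e : R) : settles -> 0 < e -> exists k : nat, osc_le e (W t k).
Proof.
move=> h e0; have [j je] : exists j : nat, j.+1%:R^-1 <= e.
  exists (Num.truncn e^-1); rewrite invf_ple ?posrE //; exact/ltW/truncnS_gt.
have [k /osc_leP osc] := h t j; exists k; apply/osc_leP => x x' y.
exact: le_trans (osc x x' y) je.
Qed.

(** Extending the past beyond [k] keeps each entry within the oscillation reached at [k], so the
    entries of a reference row [x0] are Cauchy; the other rows have the same limit. *)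
Lemma settles_limit_law : (0 < n)%N -> settles -> exists pi, is_limit_law Pm pi.
Proof.
move=> n0 stl; pose x0 := Ordinal n0.
have cv t y : cvg ((fun k => W t k x0 y) @ \oo).
  apply/cauchy_cvgP/cauchy_exP => e e0.
  have [k osc] := settles_osc t stl (divr_gt0 e0 (ltr0Sn R 1)).
  exists (W t k x0 y); exists k => // m /= km.
  have [A stA ->] := walk_past_split t km.
  rewrite /ball /= distrC (le_lt_trans (osc_le_average x0 x0 y stA osc)) //; lra.
exists (fun t => \row_y lim ((fun k => W t k x0 y) @ \oo)) => t x y.
rewrite mxE; under eq_fun do rewrite prod_mx_past.
apply/cvgrPdist_le => e e0; have e2 : 0 < e / 2 by rewrite divr_gt0.
have [k osc] := settles_osc t stl e2.
have /cvgrPdist_le/(_ _ e2) near_lim := cv t y.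
near=> m.
have km : (k <= m)%N by near: m; exact: nbhs_infty_ge.
have [A stA eqW] := walk_past_split t km.
rewrite -(subrKA (W t m x0 y)) [e]splitr (le_trans (ler_normD _ _)) // lerD //.
  by near: m.
by rewrite eqW; have /osc_leP := osc_leM stA osc; apply.
Unshelve. all: by end_near. Qed.

(** This converse is what makes the mixing event equal to a measurable set, instead of merely
    containing one. *)
Lemma limit_law_settles pi : is_limit_law Pm pi -> settles.
Proof.
move=> lim_pi t j; have e0 : 0 < j.+1%:R^-1 / 2 :> R by rewrite divr_gt0 ?invr_gt0.
have : \forall k \near \oo, forall x y, `|pi t 0 y - W t k x y| <= j.+1%:R^-1 / 2.
  apply: filter_forall => x; apply: filter_forall => y.
  have := lim_pi t x y; under eq_fun do rewrite prod_mx_past.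
  by move=> /cvgrPdist_le/(_ _ e0).
move=> [k _ /(_ k (leqnn k)) /= near_pi]; exists k; apply/osc_leP => x x' y.
rewrite -(subrKA (pi t 0 y)) (le_trans (ler_normD _ _)) // distrC.
by rewrite [leRHS]splitr lerD.
Qed.

Lemma limit_law_past pi t x y : is_limit_law Pm pi ->
  (fun k => W t k x y) @ \oo --> pi t 0 y.
Proof. by move=> /(_ t x y); under eq_fun do rewrite prod_mx_past. Qed.

Lemma mix_dist_le (pi : int -> 'rV[R]_n) (t : nat) (e : R) : 0 <= e ->
  mix_dist Pm pi t <= e <-> forall x, tv_dist (row x (W t%:Z t)) (pi t%:Z) <= e.
Proof.
move=> e0; rewrite /mix_dist -prod_mx_past subrr.
split=> [h x|h]; first exact: le_trans (le_bigmax _ _ x) h.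
by apply/bigmax_leP; split.
Qed.

(** Each row of a longer walk averages the rows of [W t t], so in the limit [pi t] is within [e / n]
    of each row entrywise. Summing over [n] entries gives [e]; the factor 1/2 is bounded by 1. *)
Lemma osc_mix_dist pi (t : nat) (e : R) : (0 < n)%N -> 0 < e -> is_limit_law Pm pi ->
  osc_le (e / n%:R) (W t%:Z t) -> mix_dist Pm pi t <= e.
Proof.
move=> n0 e0 lim_pi osc; apply/mix_dist_le => [|x]; first exact: ltW.
rewrite /tv_dist -[leRHS]mul1r ler_pM ?sumr_ge0 ?invr_ge0 ?invf_le1 ?ler1n //.
apply: (@le_trans _ _ (\sum_(y < n) e / n%:R)); last first.
  by rewrite sumr_const card_ord -[(e / _) *+ n]mulr_natr divfK // pnatr_eq0 -lt0n.
apply: ler_sum => y _; rewrite mxE distrC.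
have lim_norm : (fun k => `|W t%:Z k x y - W t%:Z t x y|) @ \oo -->
    `|pi t%:Z 0 y - W t%:Z t x y|.
  by apply: cvg_norm; apply: cvgB; [exact: limit_law_past | exact: cvg_cst].
rewrite -(cvg_lim _ lim_norm) //; apply: limr_le; first by apply/cvg_ex; eexists; exact: lim_norm.
near=> k; have tk : (t <= k)%N by near: k; exact: nbhs_infty_ge.
have [A stA eqW] := walk_past_split t%:Z tk.
by rewrite /= [X in X - _](_ : _ = (A *m W t%:Z t) x y) ?eqW // osc_le_average.
Unshelve. all: by end_near. Qed.

Definition close_past (e : R) (l1 l2 : seq (sgraph n)) : bool :=
  [forall x, tv_dist (row x (walk_mx R l1)) (row x (walk_mx R l2)) <= e].

(** The condition [mix_dist Pm pi t <= e] with [pi] replaced by long walks. The slack is needed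
    because a limit at most [e] only forces the terms to be eventually at most [e] plus any positive
    number. *)
Definition mixes_by (e : R) (t : nat) := forall j : nat, exists N : nat, forall m : nat,
  close_past (e + j.+1%:R^-1) (past t%:Z t) (past t%:Z (N + m)).

Lemma mix_dist_mixes_by pi (t : nat) (e : R) : 0 <= e -> is_limit_law Pm pi ->
  mix_dist Pm pi t <= e <-> mixes_by e t.
Proof.
move=> e0 lim_pi.
have cv x : (fun k => tv_dist (row x (W t%:Z t)) (row x (W t%:Z k))) @ \oo -->
    tv_dist (row x (W t%:Z t)) (pi t%:Z).
  apply: cvgM; first exact: cvg_cst.
  apply: cvg_big => [|y _]; first exact: add_continuous.
  apply: cvg_norm; apply: cvgB; first exact: cvg_cst.
  under eq_fun do rewrite mxE; exact: limit_law_past.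
rewrite mix_dist_le //; split=> [h j|h x].
  have j0 : 0 < j.+1%:R^-1 :> R by rewrite invr_gt0.
  have : \forall k \near \oo, forall x,
      tv_dist (row x (W t%:Z t)) (row x (W t%:Z k)) <= e + j.+1%:R^-1.
    apply: filter_forall => x; have /cvgrPdist_le/(_ _ j0) := cv x.
    apply: filterS => k; rewrite ler_distlC => /andP[_ /le_trans]; apply.
    by rewrite lerD2r.
  by move=> [N _ hN]; exists N => m; apply/forallP => x; apply: hN; rewrite /= leq_addr.
apply/ler_addgt0Pr => d d0; rewrite -(cvg_lim _ (cv x)) //.
have [j je] : exists j : nat, j.+1%:R^-1 <= d.
  exists (Num.truncn d^-1); rewrite invf_ple ?posrE //; exact/ltW/truncnS_gt.
have [N hN] := h j.
apply: limr_le; first by apply/cvg_ex; eexists; exact: cv.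
near=> k; have Nk : (N <= k)%N by near: k; exact: nbhs_infty_ge.
have /forallP/(_ x) := hN (k - N)%N; rewrite subnKC // => /le_trans; apply.
by rewrite lerD2l.
Unshelve. all: by end_near. Qed.

Lemma tmix_le (pi : int -> 'rV[R]_n) (e c : R) : 0 <= c ->
  (tmix Pm pi e <= c%:E)%E <-> exists2 t : nat, t%:R <= c & mix_dist Pm pi t <= e.
Proof.
move=> c0; split=> [le_c|[t tc mix_t]]; last first.
  by apply: (@le_trans _ _ (t%:R)%:E); [apply: ereal_inf_lbound; exists t | rewrite lee_fin].
(* Qualifying times are integers: if none is at most [c], all are at least [(Num.truncn c).+1],
   which exceeds [c]. An empty set of times, with infimum [+oo], is covered too. *)
apply: contrapT => no_t; have : ((Num.truncn c).+1%:R%:E <= tmix Pm pi e)%E.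
  apply/ereal_infP => _ [t /= mix_t <-]; rewrite lee_fin ler_nat ltnNge.
  by apply/negP => tc; apply: no_t; exists t => //; rewrite -truncn_ge_nat.
move=> /le_trans/(_ le_c); rewrite lee_fin leNgt => /negP; apply; exact: truncnS_gt.
Qed.

(** Trades the uncountable quantifier over [pi] for countable ones, in view of measurability. *)
Lemma mixing_eventP (e c : R) : (0 < n)%N -> 0 <= e -> 0 <= c ->
  (exists2 pi, is_limit_law Pm pi & (tmix Pm pi e <= c%:E)%E) <->
  settles /\ exists2 t : nat, t%:R <= c & mixes_by e t.
Proof.
move=> n0 e0 c0; split=> [[pi lim_pi /(tmix_le _ _ c0)[t tc /mix_dist_mixes_by mix_t]]|].
  by split; [exact: limit_law_settles lim_pi | exists t => //; exact: mix_t].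
move=> [/(settles_limit_law n0)[pi lim_pi] [t tc mix_t]]; exists pi => //.
by apply/tmix_le => //; exists t => //; apply/mix_dist_mixes_by.
Qed.

Lemma mixing_event_osc (e c : R) (t : nat) : (0 < n)%N -> 0 < e -> t%:R <= c ->
  settles -> osc_le (e / n%:R) (W t%:Z t) ->
  exists2 pi, is_limit_law Pm pi & (tmix Pm pi e <= c%:E)%E.
Proof.
move=> n0 e0 tc /(settles_limit_law n0)[pi lim_pi] osc; exists pi => //.
apply/tmix_le; first exact: le_trans tc.
by exists t => //; apply: osc_mix_dist.
Qed.

End Past.

(** * Probabilities of the random sequence *)

Section Countable.
Context d (T : measurableType d) (R : realType) (P : probability T R).

Lemma measurable_exists (I : countType) (F : I -> set T) :
  (forall i, measurable (F i)) -> measurable [set w | exists i, F i w].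
Proof.
move=> mF; rewrite [X in measurable X](_ : _ = \bigcup_i F i).
  apply: countable_bigcupT_measurable => //; exact: countableP.
by apply/seteqP; split=> w; [move=> [i Fiw]; exists i | move=> [i _ Fiw]; exists i].
Qed.

Lemma measurable_forall (I : countType) (F : I -> set T) :
  (forall i, measurable (F i)) -> measurable [set w | forall i, F i w].
Proof.
move=> mF; rewrite [X in measurable X](_ : _ = ~` [set w | exists i, (~` F i) w]).
  by apply: measurableC; apply: measurable_exists => i; exact: measurableC.
apply/seteqP; split=> w /= h; first by move=> [i]; apply.
by move=> i; apply: contrapT => Fiw; apply: h; exists i.
Qed.

Lemma negligible_exists (I : countType) (F : I -> set T) :
  (forall i, P.-negligible (F i)) -> P.-negligible [set w | exists i, F i w].
Proof.
(* Indices are enumerated by their codes; a natural number that codes nothing receives the empty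
   set. *)
move=> nF; pose F' k := if @unpickle I k is Some i then F i else set0.
apply: (@negligibleS _ _ _ _ (\bigcup_k F' k)).
  by move=> w [i Fiw]; exists (pickle i) => //; rewrite /F' pickleK.
apply: negligible_bigcup => k; rewrite /F'; case: unpickle => //.
exact: negligible_set0.
Qed.

Section FiniteValued.
Variables (F : finType) (Y : T -> F).
Hypothesis mY : forall y, measurable [set w | Y w = y].

Let preimE (D : pred F) : [set w | D (Y w)] = \bigcup_(y in [set` D]) [set w | Y w = y].
Proof.
by apply/seteqP; split=> w /=; [move=> Dw; exists (Y w) | move=> [y Dy /= ->]].
Qed.

Lemma finite_valued_measurable (D : pred F) : measurable [set w | D (Y w)].
Proof. by rewrite preimE; apply: fin_bigcup_measurable => //; exact: finite_finset. Qed.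

Lemma finite_valued_probability (D : pred F) (f : F -> R) :
  (forall y, P [set w | Y w = y] = (f y)%:E) ->
  P [set w | D (Y w)] = (\sum_(y | D y) f y)%:E.
Proof.
move=> PY; rewrite preimE measure_fin_bigcup //=; last first.
  by move=> y z _ _ [w [/= <- <-]].
rewrite [X in _ = X%:E](_ : _ = \sum_(y <- enum D) f y); last by rewrite big_enum.
rewrite -sumEFin (fsbig_seq _ _ (enum_uniq D)) (_ : [set` D] = [set` enum D]).
  by apply: eq_fsbigr => y _; exact: PY.
by apply/seteqP; split=> y /=; rewrite mem_enum.
Qed.

End FiniteValued.

Lemma measurable_pair_fibers (F1 F2 : finType) (Y1 : T -> F1) (Y2 : T -> F2) :
  (forall y, measurable [set w | Y1 w = y]) -> (forall y, measurable [set w | Y2 w = y]) ->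
  forall y, measurable [set w | (Y1 w, Y2 w) = y].
Proof.
move=> m1 m2 [y1 y2]; rewrite [X in measurable X](_ : _ = [set w | Y1 w = y1] `&` [set w | Y2 w = y2]).
  exact: measurableI.
by apply/seteqP; split=> w /= [-> ->].
Qed.

End Countable.

(** * Law of the i.i.d. graph sequence *)

Section GraphLaw.
Context d (T : measurableType d) (R : realType) (P : probability T R).
Variables (n : nat) (p : R).

Lemma graph_fiber_measurable (G : T -> sgraph n) (g : sgraph n) :
  erdos_renyi P p G -> measurable [set w | G w = g].
Proof.
case=> mG _ _; rewrite [X in measurable X](_ : _ =
    [set w | forall e : edge n, (if e \in g then [set w | e \in G w] else ~` [set w | e \in G w]) w]).
  apply: measurable_forall => e; case: ifP => _ //; exact: measurableC.
apply/seteqP; split=> w /=; first by move=> <- e; case: ifPn => // /negP.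
move=> h; apply/setP => e; have := h e; case: (e \in g) => /= [-> //|].
by move/negP/negbTE.
Qed.

(** The event that [G] contains [S] is an intersection of independent edge events of probability
    [p]. *)
Lemma graph_upper (G : T -> sgraph n) : erdos_renyi P p G ->
  forall S : {set edge n},
  \sum_(g : {set edge n} | S \subset g) fine (P [set w | G w = g]) = p ^+ #|S|.
Proof.
move=> erG S; have mG g := graph_fiber_measurable g erG.
have [_ Pe ind] := erG; apply: EFin_inj.
rewrite -(@finite_valued_probability _ _ _ P _ _ mG (fun g : sgraph n => S \subset g)); last first.
  by move=> g; rewrite fineK // fin_num_measure.
rewrite (_ : [set w | _] = \bigcap_(e in [set` enum S]) [set w | e \in G w]); last first.
  apply/seteqP; split=> w /=.
    by move=> /fintype.subsetP SG e /=; rewrite mem_enum; exact: SG.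
  by move=> h; apply/fintype.subsetP => e eS; apply: h; rewrite /= mem_enum.
rewrite ind ?enum_uniq // (eq_bigr (fun=> p%:E)) => [|e _]; last exact: Pe.
by rewrite prodEFin big_const_seq count_predT -cardE -Monoid.iteropE.
Qed.

Variable G : int -> T -> sgraph n.
Hypothesis iidG : iid_erdos_renyi P p G.

(** Time 0 is an arbitrary reference: [graph_lawE] shows that all times share this law. *)
Definition graph_law (g : sgraph n) : R := fine (P [set w | G 0 w = g]).

Lemma graph_law_ge0 g : 0 <= graph_law g.
Proof. exact: fine_ge0. Qed.

Lemma graph_law_upper (S : {set edge n}) :
  \sum_(g : {set edge n} | S \subset g) graph_law g = p ^+ #|S|.
Proof. exact: graph_upper (iidG.1 0) S. Qed.

Lemma graph_lawE t g : P [set w | G t w = g] = (graph_law g)%:E.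
Proof.
rewrite -[LHS]fineK ?fin_num_measure //; last exact: graph_fiber_measurable (iidG.1 t).
congr EFin; move: g; apply: eq_from_upper_sums => S.
by rewrite graph_law_upper; exact: graph_upper (iidG.1 t) S.
Qed.

Let absz_subK (t : int) (i : nat) : absz (t - (t - i%:Z))%R = i.
Proof. by rewrite opprB addrC subrK absz_nat. Qed.

(** Brings the event into the form required by independence over times. The index [absz (t - z)]
    recovers the position in [l]; it stays below [k], so the default of [nth] is never returned. *)
Let pastE t k (l : k.-tuple (sgraph n)) :
  [set w | past (G^~ w) t k = l] =
  \bigcap_(z in [set` [seq t - i%:Z | i <- iota 0 k]])
    [set w | G z w \in [set nth finset.set0 l (absz (t - z)%R)]%SET].
Proof.
apply/seteqP; split=> w /=.
  move=> pl z /= /mapP[i]; rewrite mem_iota add0n => /andP[_ ik] ->.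
  by rewrite absz_subK inE -pl /= (nth_map 0%N) ?size_iota // nth_iota ?add0n.
move=> h; apply: val_inj; apply: (@eq_from_nth _ finset.set0) => [|i]; rewrite !size_tuple // => ik.
have := h (t - i%:Z); rewrite /= absz_subK inE => {}h.
rewrite (nth_map 0%N) ?size_iota // nth_iota // add0n; apply/eqP/h/map_f.
by rewrite mem_iota.
Qed.

Lemma past_fiber_measurable t k (l : k.-tuple (sgraph n)) :
  measurable [set w | past (G^~ w) t k = l].
Proof.
rewrite pastE; apply: fin_bigcap_measurable; first exact: finite_seq.
move=> z _; apply: (@finite_valued_measurable _ _ _ (G z) _ (mem [set _]%SET)) => g.
exact: graph_fiber_measurable (iidG.1 z).
Qed.

Lemma past_law t k (l : k.-tuple (sgraph n)) :
  P [set w | past (G^~ w) t k = l] = (\prod_(g <- l) graph_law g)%:E.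
Proof.
rewrite pastE (iidG.2 (fun z => [set nth finset.set0 l (absz (t - z)%R)]%SET)); last first.
  (* The times [t - i] are pairwise distinct, as independence requires. *)
  by rewrite map_inj_uniq ?iota_uniq // => i j /addrI/oppr_inj[].
rewrite big_map -prodEFin (big_nth finset.set0) size_tuple /index_iota subn0.
apply: eq_bigr => i _; rewrite absz_subK -(graph_lawE (t - i%:Z)).
by congr (P _); apply/seteqP; split=> w /=; rewrite inE => /eqP.
Qed.

Definition osc_event (dlt : R) (t : int) (k : nat) : set T :=
  [set w | osc_le dlt (walk_mx R (past (G^~ w) t k))].

Lemma osc_event_measurable dlt t k : measurable (osc_event dlt t k).
Proof.
exact: (finite_valued_measurable (@past_fiber_measurable t k) (fun l => osc_le dlt (walk_mx R l))).
Qed.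

Hypothesis p_gt0 : 0 < p.
Hypothesis n_gt1 : (1 < n)%N.
Let r : R := 2^-1 + 2^-1 * (n.-1%:R * p)^-1.

Lemma osc_event_probability dlt t k : 0 < dlt ->
  (P (~` osc_event dlt t k) <= (r ^+ k * n%:R ^+ 3 / dlt ^+ 2)%:E)%E.
Proof.
move=> dlt0; rewrite (_ : ~` _ =
    [set w | ~~ osc_le dlt (walk_mx R (past (G^~ w) t k))]); last first.
  by apply/seteqP; split=> w /negP.
rewrite (finite_valued_probability (@past_fiber_measurable t k)
  (fun l => ~~ osc_le dlt (walk_mx R l)) (@past_law t k)) lee_fin.
exact: osc_markov graph_law_ge0 graph_law_upper _ _ dlt0.
Qed.

Lemma settles_measurable : measurable [set w | settles R (G^~ w)].
Proof.
apply: measurable_forall => t; apply: measurable_forall => j; apply: measurable_exists => k.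
exact: osc_event_measurable.
Qed.

(** For fixed [t] and [j], failure at every [k] has probability at most a constant times [r ^+ k]
    for each [k], hence 0. There are countably many pairs [(t, j)]. *)
Lemma settles_as : r < 1 -> P (~` [set w | settles R (G^~ w)]) = 0%E.
Proof.
move=> r1; have r0 : 0 <= r by rewrite addr_ge0 ?mulr_ge0 ?invr_ge0 ?mulr_ge0 // ltW.
apply: measure_negligible; first exact/measurableC/settles_measurable.
pose F (tj : int * nat) : set T := [set w | forall k, (~` osc_event tj.2.+1%:R^-1 tj.1 k) w].
apply: (@negligibleS _ _ _ _ [set w | exists tj, F tj w]).
  move=> w /= ns; apply: contrapT => no_tj; apply: ns => t j; apply: contrapT => no_k.
  by apply: no_tj; exists (t, j) => k /= osc; apply: no_k; exists k.
apply: negligible_exists => -[t j].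
have mF : measurable (F (t, j)).
  by apply: measurable_forall => k; exact/measurableC/osc_event_measurable.
apply/negligibleP => //; apply/eqP; rewrite eq_le measure_ge0 andbT.
rewrite -[leLHS]fineK ?fin_num_measure // lee_fin.
pose C := n%:R ^+ 3 / j.+1%:R^-1 ^+ 2 : R.
have cvC : (fun k => r ^+ k * C) @ \oo --> (0 : R).
  rewrite -[X in _ --> X](mul0r C); apply: cvgM; last exact: cvg_cst.
  by apply: cvg_expr; rewrite ger0_norm.
rewrite -(cvg_lim _ cvC) //; apply: limr_ge; first by apply/cvg_ex; exists 0.
apply: nearW => k; rewrite -lee_fin fineK ?fin_num_measure //.
apply: (@le_trans _ _ (P (~` osc_event j.+1%:R^-1 t k))).
  apply: le_measure; rewrite ?inE //.
  exact/measurableC/osc_event_measurable.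
by rewrite /C mulrA; apply: osc_event_probability; rewrite invr_gt0.
Qed.

Definition mixing_event (e c : R) : set T :=
  [set w | exists2 pi : int -> 'rV[R]_n,
    is_limit_law (fun t : int => trans_mx R (G t w)) pi &
    (tmix (fun t : int => trans_mx R (G t w)) pi e <= c%:E)%E].

(* Needed because a measure takes arbitrary values on non-measurable sets. *)
Lemma mixing_event_measurable e c : 0 <= e -> 0 <= c -> measurable (mixing_event e c).
Proof.
move=> e0 c0; rewrite [X in measurable X](_ : _ = [set w | settles R (G^~ w)] `&`
    [set w | exists t : nat, ([set w | t%:R <= c] `&` [set w | mixes_by (G^~ w) e t]) w]).
  apply: measurableI; first exact: settles_measurable.
  apply: measurable_exists => t; apply: measurableI.
    have [tc|tc] := boolP (t%:R <= c); first by rewrite (_ : [set _ | _] = setT) //; apply/seteqP.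
    by rewrite (_ : [set _ | _] = set0) //; apply/seteqP; split.
  apply: measurable_forall => j; apply: measurable_exists => N; apply: measurable_forall => m.
  apply: (finite_valued_measurable (measurable_pair_fibers (@past_fiber_measurable t%:Z t)
    (@past_fiber_measurable t%:Z (N + m))) (fun l => close_past (e + j.+1%:R^-1) l.1 l.2)).
apply/seteqP; split=> w.
  by move/(mixing_eventP _ (ltnW n_gt1) e0 c0) => [? [t ? ?]]; split => //; exists t.
by move=> [? [t [? ?]]]; apply/(mixing_eventP _ (ltnW n_gt1) e0 c0); split => //; exists t.
Qed.

(** Union bound over two obstructions: [settles] fails with probability 0, and the rows are not yet
    within [e / n] after [t] steps with the probability bounded by Markov. *)
Lemma mixing_event_probability (e c : R) (t : nat) : 0 < e -> t%:R <= c -> r < 1 ->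
  ((1 - r ^+ t * n%:R ^+ 3 / (e / n%:R) ^+ 2)%:E <= P (mixing_event e c))%E.
Proof.
move=> e0 tc r1; have c0 : 0 <= c by exact: le_trans tc.
have n0 : 0 < n%:R :> R by rewrite ltr0n ltnW.
set A := [set w | settles R (G^~ w)]; set B := osc_event (e / n%:R) t%:Z t.
have mA : measurable A := settles_measurable.
have mB : measurable B := osc_event_measurable _ _ _.
apply: (@le_trans _ _ (P (A `&` B))); last first.
  apply: le_measure; rewrite ?inE; [exact: measurableI | exact: mixing_event_measurable (ltW e0) c0 |].
  by move=> w [stl osc]; apply: mixing_event_osc osc => //; exact: ltnW.
rewrite -[A `&` B]setCK probability_setC; last exact/measurableC/measurableI.
rewrite EFinB leeB // setCI; apply: (@le_trans _ _ (P (~` A) + P (~` B))%E).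
  by apply: measureU2; exact: measurableC.
have -> : P (~` A) = 0%E := settles_as r1.
by rewrite add0e; apply: osc_event_probability; rewrite divr_gt0.
Qed.

End GraphLaw.

(** * Asymptotics *)

Lemma near_ln_ge (R : realType) (a : R) : \forall n \near \oo, a <= ln (n%:R : R).
Proof.
exists (Num.truncn (expR a)).+1 => // n /= n_ge.
have lt_n : expR a < n%:R by apply: lt_le_trans (truncnS_gt _) _; rewrite ler_nat.
by rewrite -[a]expRK ler_ln ?posrE ?expR_gt0 ?(lt_trans (expR_gt0 a)) // ltW.
Qed.

Lemma large_gt1 (R : realType) (eta : R) (n : nat) : 50 < eta ->
  2 * eta + 1 <= ln (n%:R : R) -> (1 < n)%N.
Proof.
move=> heta n_large; rewrite ltnNge; apply/negP => n_le1.
(* This covers [n = 0] as well, where the logarithm has a conventional nonpositive value. *)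
have ln_le : ln (n%:R : R) <= 0 by rewrite ln_le0 // lern1.
lra.
Qed.

Lemma edge_prob_itv (R : realType) (eta : R) (n : nat) : 50 < eta ->
  2 * eta + 1 <= ln (n%:R : R) -> 0 < edge_prob eta n < 1.
Proof.
move=> heta n_large; have n_gt1 := large_gt1 heta n_large.
have n_gt0 : 0 < n%:R :> R by rewrite ltr0n ltnW.
have n1 : 0 < n%:R - 1 :> R by rewrite subr_gt0 ltr1n n_gt1.
rewrite /edge_prob divr_gt0 ?mulr_gt0 //=; [|lra..].
rewrite ltr_pdivrMr // mul1r; have x0 : 0 <= ln (n%:R : R) by lra.
(* With [x = ln n], the bound [expR x >= 1 + x ^+ 2 / 2] gives [n - 1 >= x ^+ 2 / 2], which exceeds
   [eta * x] once [x > 2 * eta]; hence the threshold [2 * eta + 1]. *)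
have := expR_ge1Dxn 1 x0; rewrite lnK ?posrE // => le_n.
have e2 : (2`!)%:R = 2 :> R by [].
rewrite e2 in le_n; nra.
Qed.

(** The mean degree [(n - 1) * p] equals [eta * ln n], and the bound 3/4 only asks that it be at
    least 2. *)
Lemma contraction_rate_le (R : realType) (eta : R) (n : nat) : 50 < eta ->
  2 * eta + 1 <= ln (n%:R : R) -> 
  2^-1 + 2^-1 * (n.-1%:R * edge_prob eta n)^-1 <= 3 / 4.
Proof.
move=> heta n_large; have n_gt1 := large_gt1 heta n_large.
have n1 : n.-1%:R = n%:R - 1 :> R by rewrite -subn1 natrB ?n_gt1 // ltnW ?n_gt1.
have n1' : n%:R - 1 != 0 :> R by rewrite subr_eq0 pnatr_eq1 gtn_eqF ?n_gt1.
rewrite n1 /edge_prob [_ * (_ / _)]mulrC divfK //.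
suff : (eta * ln (n%:R : R))^-1 <= 2^-1 by move=> ?; lra.
by rewrite lef_pV2 ?posrE; nra.
Qed.

Lemma failure_bound (R : realType) (eta : R) (n : nat) (e : R) : 50 < eta ->
  2 * eta + 1 <= ln (n%:R : R) -> 0 < e ->
  (2^-1 + 2^-1 * (n.-1%:R * edge_prob eta n)^-1) ^+ Num.truncn (24 * ln (n%:R : R))
    * n%:R ^+ 3 / (e / n%:R) ^+ 2
  <= expR 4^-1 / e ^+ 2 * 2 * harmonic n.
Proof.
move=> heta n_large e0; have n_gt1 := large_gt1 heta n_large.
have n_gt0 : 0 < n%:R :> R by rewrite ltr0n ltnW.
set r := 2^-1 + _; set x := ln (n%:R : R); set t := Num.truncn _.
have en0 : e != 0 by rewrite gt_eqF.
have r0 : 0 <= r.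
  have /andP[p0 _] := edge_prob_itv heta n_large.
  by rewrite addr_ge0 // mulr_ge0 // invr_ge0 (mulr_ge0 _ (ltW p0)).
(* From [3 / 4 <= expR (- 4^-1)] and [t > 24 * x - 1]; the summand [4^-1] pays for the
   truncation. *)
have rt : r ^+ t <= expR (4^-1 - 6 * x).
  apply: (@le_trans _ _ (expR (- 4^-1) ^+ t)).
    apply: lerXn2r; rewrite ?nnegrE ?expR_ge0 //.
    by apply: le_trans (expR_ge1Dx _); apply: le_trans (contraction_rate_le heta n_large) _; lra.
  rewrite -expRM_natl ler_expR; have := truncnS_gt (24 * x).
  by rewrite -/t -natr1 => ?; lra.
have nE : n%:R = expR x by rewrite /x lnK ?posrE.
rewrite [leLHS](_ : _ = (r ^+ t * n%:R ^+ 5) / e ^+ 2); last first.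
  by field; rewrite en0 gt_eqF.
rewrite [leRHS](_ : _ = expR 4^-1 * (2 * harmonic n) / e ^+ 2); last by ring.
rewrite ler_wpM2r ?invr_ge0 ?sqr_ge0 //.
apply: (@le_trans _ _ (expR 4^-1 * n%:R^-1)).
  apply: (@le_trans _ _ (expR (4^-1 - 6 * x) * n%:R ^+ 5)).
    by rewrite ler_wpM2r // exprn_ge0.
  by rewrite nE -expRM_natl -expRN -!expRD ler_expR; lra.
(* [harmonic n] is the inverse of [n + 1], and [n + 1 <= 2 * n] accounts for the factor 2. *)
rewrite ler_wpM2l ?expR_ge0 // /harmonic /=.
rewrite -[2 in leRHS]invrK -invfM lef_pV2 ?posrE ?mulr_gt0 ?invr_gt0 //.
rewrite mulrC ler_pdivrMr // -natr1; have n1 : 1 <= n%:R :> R by rewrite ler1n -(ltr0n R).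
lra.
Qed.

Theorem theorem5p1 (R : realType) (eta : R) (heta : 50 < eta) :
  exists c' : R,
  forall (d : nat -> measure_display) (T : forall n : nat, measurableType (d n))
    (P : forall n : nat, probability (T n) R)
    (G : forall n : nat, int -> T n -> sgraph n),
  (forall n : nat, 0 < edge_prob eta n < 1 ->
     iid_erdos_renyi (P n) (edge_prob eta n) (G n)) ->
  forall eps : R, 0 < eps < 1 ->
  (fun n : nat =>
     P n [set w : T n |
       exists2 pi : int -> 'rV[R]_n,
         is_limit_law (fun t : int => trans_mx R (G n t w)) pi &
         (tmix (fun t : int => trans_mx R (G n t w)) pi eps
            <= (c' * (ln n%:R + ln eps^-1))%:E)%E]) @ \oo --> 1%E.
Proof.
(* After [24 log n] steps [(3/4)^t] is at most of order [n^-6], against the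
   factor [n^5] lost in Markov's inequality. *)
exists 24 => d T P G iidG eps /andP[eps0 eps1].
have lneps : 0 <= ln eps^-1 by rewrite ln_ge0 // invf_ge1 // ltW.
set K := expR 4^-1 / eps ^+ 2 * 2.
apply: (@squeeze_cvge _ _ _ _ (fun n => (1 - K * harmonic n)%:E) _ (fun=> 1%E)).
(* For such [n] the edge probability lies in (0,1), so the hypothesis on [G] applies. *)
- have := near_ln_ge (2 * eta + 1); apply: filterS => n n_large.
  have n_gt1 := large_gt1 heta n_large.
  have p01 := edge_prob_itv heta n_large; have /andP[p0 _] := p01.
  have x0 : 0 <= ln (n%:R : R) by lra.
  have iid_n := iidG n p01.
  apply/andP; split; last first.
    apply: probability_le1; apply: (mixing_event_measurable iid_n) => //; first exact: ltW.
    by rewrite mulr_ge0 ?addr_ge0.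
  apply: le_trans; last first.
    apply: (mixing_event_probability iid_n p0 n_gt1 (t := Num.truncn (24 * ln (n%:R : R)))) => //.
      apply: (@le_trans _ _ (24 * ln n%:R)); first by rewrite truncn_le mulr_ge0.
      by rewrite ler_wpM2l // lerDl.
    by apply: le_lt_trans (contraction_rate_le heta n_large) _; lra.
  by rewrite lee_fin lerD2l lerN2; apply: failure_bound.
- apply: cvg_EFin; first exact: nearW.
  rewrite -[X in _ --> X]subr0 -[X in _ - X](mulr0 K).
  by apply: cvgB; [exact: cvg_cst | apply: cvgM; [exact: cvg_cst | exact: cvg_harmonic]].
- exact: cvg_cst.
Qed.
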